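(* Let $\mathbb{F}$ be a field of characteristic zero, let $\alpha_{1},\ldots,\alpha_{s}$ be distinct elements of $\mathbb{F}$, let $m_{1},\ldots,m_{s}$ be positive integers with $m_{1}+\cdots+m_{s}=n$, and let $P(x)=(x-\alpha_{1})^{m_{1}}(x-\alpha_{2})^{m_{2}}\cdots(x-\alpha_{s})^{m_{s}}$. Let $V_{G}(P)$ be the confluent Vandermonde matrix of $P$ and let $L_{jk_j}(x)[P]$ be the polynomials defined in the context. Then the inverse of $V_{G}(P)$ is $$V_{G}^{-1}(P)=\begin{pmatrix}\mathcal{L}_{1m_{1}}\\ \mathcal{L}_{2m_{2}}\\ \vdots\\ \mathcal{L}_{sm_{s}}\end{pmatrix},$$ where for $r=1,2,\ldots,s$ the block $\mathcal{L}_{rm_{r}}$ is the $m_{r}\times n$ matrix $$\mathcal{L}_{rm_{r}}=\left(\frac{1}{(j-1)!}L^{(j-1)}_{r(i-1)}(0)[P]\right)_{1\leq i\leq m_{r},\,1\leq j\leq n}.$$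
   Context: Polynomials $L_{jk_j}(x)[P]$: for $1\le j\le s$ put $P_{j}(x)=\prod_{i=1,i\neq j}^{s}(x-\alpha_{i})^{m_{i}}=P(x)/(x-\alpha_j)^{m_j}$ and $g_{j}(x)=(P_{j}(x))^{-1}$ (a rational function regular at $\alpha_j$; $g_j^{(i)}$ is its $i$th formal derivative). For $1\le j\le s$ and $0\le k_j\le m_j-1$, $$L_{jk_{j}}(x)[P]=P_{j}(x)(x-\alpha_{j})^{k_{j}}\sum_{i=0}^{m_{j}-1-k_{j}}\frac{1}{i!}g^{(i)}_{j}(\alpha_{j})(x-\alpha_{j})^{i}.$$ $L^{(l)}_{jk_j}(x)[P]$ denotes the $l$th derivative of $L_{jk_j}(x)[P]$, and $L^{(l)}_{jk_j}(a)[P]$ its value at $x=a$. Confluent Vandermonde matrix: $V_{G}(P)=(V_{1}\ V_{2}\ \cdots\ V_{s})$ is the $n\times n$ matrix whose block $V_{k}$ is the $n\times m_{k}$ matrix with entries $(V_{k})_{ij}=\binom{i-1}{j-1}\alpha_{k}^{i-j}$ if $i\ge j$ and $0$ otherwise (with $0^0=1$). *)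

(* Defs.v *)
From mathcomp Require Import all_boot all_order all_algebra.
From mathcomp Require Import ring.

Set Implicit Arguments.
Unset Strict Implicit.
Unset Printing Implicit Defensive.

Import GRing.Theory.
Local Open Scope ring_scope.

Notation "p %:F" := (@FracField.tofrac _ p)
  (at level 1, format "p %:F") : ring_scope.

Section Fractions.
Variable R : idomainType.
Implicit Types (f : {fraction R}) (p q : R).

Lemma frac_repr f : f = (\n_(repr f))%:F / (\d_(repr f))%:F.
Proof.
have d0 : (\d_(repr f))%:F != 0 by rewrite tofrac_eq0 denom_ratioP.
apply: (mulIf d0); rewrite divfK //.
rewrite -{1}[f]reprK.
case: (repr f) => [[n d] /= nd] in d0 *.
rewrite -[LHS]/(FracField.mul _ _); unlock FracField.tofrac.
rewrite -FracField.pi_mul; apply/eqmodP.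
rewrite /= FracField.equivfE /FracField.mulf /=.
by rewrite !numden_Ratio ?mulf_neq0 ?oner_neq0 //= !mulr1 mulrC.
Qed.

Lemma repr_div p q : q != 0 ->
  p * \d_(repr (p%:F / q%:F)) = \n_(repr (p%:F / q%:F)) * q.
Proof.
move=> q0; have := frac_repr (p%:F / q%:F).
have := denom_ratioP (repr (p%:F / q%:F)).
move: (\n_ _) (\d_ _) => n d d0 /eqP.
by rewrite eqr_div ?tofrac_eq0 // -!tofracM tofrac_eq => /eqP.
Qed.
End Fractions.

Section RationalFunctions.
Variable F : fieldType.
Implicit Types (f : {fraction {poly F}}) (p q : {poly F}) (a : F).

(* Quotient rule on the representative [repr f] of [f]; the result does not
   depend on the representative, see [fracderiv_div]. *)
Definition fracderiv f : {fraction {poly F}} :=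
  let n := \n_(repr f) in let d := \d_(repr f) in
  (n^`() * d - n * d^`())%:F / (d ^+ 2)%:F.

Definition fracderivn i f : {fraction {poly F}} := iter i fracderiv f.

(* The value at [a] is read off the reduced form of [f], so that it is the
   actual value whenever [f] is regular at [a], see [fraceval_div]; at a pole
   it is 0 by the convention [0^-1 = 0]. *)
Definition fraceval f a : F :=
  let n := \n_(repr f) in let d := \d_(repr f) in
  (n %/ gcdp n d).[a] / (d %/ gcdp n d).[a].

Lemma fracderiv_div p q : q != 0 ->
  fracderiv (p%:F / q%:F) = (p^`() * q - p * q^`())%:F / (q ^+ 2)%:F.
Proof.
move=> q0; rewrite /fracderiv; have := repr_div p q0.
have := denom_ratioP (repr (p%:F / q%:F)).
move: (\n_ _) (\d_ _) => n d d0 E.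
have E' : p^`() * d + p * d^`() = n^`() * q + n * q^`() by rewrite -!derivM E.
apply/eqP; rewrite eqr_div ?tofrac_eq0 ?expf_neq0 // -!tofracM tofrac_eq.
rewrite -subr_eq0; apply/eqP.
move: (p^`()) (q^`()) (n^`()) (d^`()) E' => p' q' n' d' E'.
have -> : (n' * d - n * d') * q ^+ 2 - (p' * q - p * q') * d ^+ 2
  = d * q * ((n' * q + n * q') - (p' * d + p * d'))
    + (d * q' + d' * q) * (p * d - n * q) by ring.
by rewrite E' E !subrr !mulr0 addr0.
Qed.

Lemma fraceval_div p q a :
  q.[a] != 0 -> fraceval (p%:F / q%:F) a = p.[a] / q.[a].
Proof.
move=> qa; have q0 : q != 0 by apply: contraNneq qa => ->; rewrite horner0.
rewrite /fraceval; have := repr_div p q0.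
have := denom_ratioP (repr (p%:F / q%:F)).
move: (\n_ _) (\d_ _) => n d d0 E.
set g := gcdp n d; have g0 : g != 0 by rewrite gcdp_eq0 negb_and d0 orbT.
set n1 := n %/ g; set d1 := d %/ g.
have En : n = n1 * g by rewrite divpK // dvdp_gcdl.
have Ed : d = d1 * g by rewrite divpK // dvdp_gcdr.
have E1 : p * d1 = n1 * q.
  by apply: (mulIf g0); rewrite -mulrA -Ed E En mulrAC.
have cop : coprimep d1 n1.
  by rewrite coprimep_sym coprimep_div_gcd // d0 orbT.
have d1q : d1 %| q by rewrite -(Gauss_dvdpr _ cop) -E1 dvdp_mull.
have d1a : d1.[a] != 0.
  apply: contraNneq qa => d1a; case/dvdpP: d1q => k ->.
  by rewrite hornerM d1a mulr0.
by apply/eqP; rewrite eqr_div // -!hornerM E1.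
Qed.
End RationalFunctions.

Section Confluent.
Variables (F : fieldType) (s : nat) (alpha : 'I_s -> F) (m : 'I_s -> nat).

(* [genpoly], [cofpoly j], [cofinv j] and [hermpoly j k] are P, P_j, g_j and
   L_{jk}[P]; they depend on P through its roots and multiplicities. *)
Definition genpoly : {poly F} := \prod_(i < s) ('X - (alpha i)%:P) ^+ m i.

Definition cofpoly (j : 'I_s) : {poly F} :=
  \prod_(i < s | i != j) ('X - (alpha i)%:P) ^+ m i.

Lemma genpolyE j : genpoly = ('X - (alpha j)%:P) ^+ m j * cofpoly j.
Proof. exact: bigD1. Qed.

Definition cofinv (j : 'I_s) : {fraction {poly F}} := ((cofpoly j)%:F)^-1.

Definition hermpoly (j : 'I_s) (k : nat) : {poly F} :=
  cofpoly j * ('X - (alpha j)%:P) ^+ k *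
  \sum_(0 <= i < (m j - 1 - k).+1)
    ((i`!%:R)^-1 * fraceval (fracderivn i (cofinv j)) (alpha j))
      *: ('X - (alpha j)%:P) ^+ i.

(* With 0-based indices: row [i], column [j] of the block [V_k]. *)
Definition vandermonde_block n (k : 'I_s) : 'M[F]_(n, m k) :=
  \matrix_(i < n, j < m k)
    (if (j <= i)%N then 'C(i, j)%:R * alpha k ^+ (i - j) else 0).

Definition confluent_vandermonde n : 'M[F]_(n, \sum_(k < s) m k) :=
  \mxrow_(k < s) vandermonde_block n k.

Definition hermite_block n (r : 'I_s) : 'M[F]_(m r, n) :=
  \matrix_(i < m r, j < n) ((j`!%:R)^-1 * (hermpoly r i)^`(j).[0]).

Definition hermite_matrix n : 'M[F]_(\sum_(r < s) m r, n) :=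
  \mxcol_(r < s) hermite_block n r.
End Confluent.

(* Main.v *)
Require Import Defs.
From mathcomp Require Import all_boot all_order all_algebra.
From mathcomp Require Import ring zify.

Import GRing.Theory.
Local Open Scope ring_scope.

(** The rows of the candidate inverse are the coefficient vectors of the
    Hermite polynomials L_rk, since the [j]th derivative at 0 divided by [j!] is
    the coefficient of [X^j]; multiplying a coefficient vector of length [n] by
    column [j] of the block [V_k] computes the Taylor coefficient of order [j]
    at [alpha k] ([coef_shift]).  The product of the two matrices is therefore
    the table of the Taylor coefficients of the L_ri at the nodes, and it is the
    identity because the L_ri are the dual basis of the Hermite interpolation
    problem:
    - at a node [alpha k] with [k != r], the factor P_r of L_ri is divisible by
      [(X - alpha k)^(m k)], so the first [m k] coefficients vanish;
    - at [alpha r], L_ri is [(X - alpha r)^i] times P_r times a Taylor section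
      of 1 / P_r, hence congruent to [(X - alpha r)^i] modulo
      [(X - alpha r)^(m r)] ([hermpoly_same_node]).
    This needs the degree of L_ri to be less than [n] ([size_hermpoly]), so that
    no coefficient is cut off.

    The analytic point is that the formal derivatives of the rational function
    1 / P_r at [a = alpha r] give its Taylor coefficients.  Instead of a power
    series one takes, by Bezout, a polynomial [W] inverse to P_r modulo
    [(X - a)^K].  The derivatives of order less than [K] at [a] of a fraction
    depend only on its class modulo [(X - a)^K] ([fraceval_fracderivn]), so those
    of 1 / P_r are those of [W], and the Taylor section of the polynomial [W] is
    congruent to [W]. *)

(** * Taylor expansion of polynomials *)

Section Taylor.
Variable F : fieldType.
Implicit Types (p q : {poly F}) (a : F).

Lemma poly_taylor_wide n p a : (size p <= n)%N ->
  p = \sum_(i < n) p^`N(i).[a] *: ('X - a%:P) ^+ i.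
Proof.
move=> sp.
(* The Taylor formula over the ring of polynomials, at the point X = a + (X - a). *)
have := @nderiv_taylor_wide {poly F} n p^:P a%:P ('X - a%:P) (mulrC _ _).
rewrite size_map_polyC addrC subrK => /(_ sp).
rewrite -/(p \Po 'X) comp_polyXr => {1}->.
by apply: eq_bigr => i _; rewrite nderivn_map horner_map mul_polyC.
Qed.

Lemma dvdp_sub_taylor n p a :
  ('X - a%:P) ^+ n %| p - \sum_(i < n) p^`N(i).[a] *: ('X - a%:P) ^+ i.
Proof.
rewrite {1}(@poly_taylor_wide (n + size p) p a) ?leq_addl //.
rewrite big_split_ord /= [X in _ %| X]addrAC subrr add0r.
apply: (big_ind (fun u => _ %| u)) => [|u v|i _];
  [exact: dvdp0 | exact: dvdp_add |].
by rewrite exprD scalerAr dvdp_mulIl.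
Qed.

(** The numbers on the right are the entries of a column of a block of the
    confluent Vandermonde matrix. *)
Lemma coef_shift n p a j : (size p <= n)%N ->
  (p \Po ('X + a%:P))`_j =
  \sum_(l < n) p`_l * (if (j <= l)%N then 'C(l, j)%:R * a ^+ (l - j) else 0).
Proof.
move=> sp.
rewrite coef_comp_poly (big_ord_widen_cond n xpredT
  (fun l => p`_l * (('X + a%:P) ^+ l)`_j)) //=.
rewrite big_mkcond /=; apply: eq_bigr => l _.
case: ltnP => [_|/(nth_default 0) ->]; last by rewrite mul0r.
congr (_ * _); rewrite addrC exprDn coef_sum.
under eq_bigr => i _ do
  rewrite -polyC_exp coefMn coefCM coefXn eq_sym.
case: leqP => [jl|lj].
  rewrite (bigD1 (Ordinal (jl : (j < l.+1)%N))) //= eqxx mulr1 big1 ?addr0 => [|i].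
    by rewrite mulr_natl.
  by rewrite -val_eqE /= => /negPf ->; rewrite mulr0 mul0rn.
rewrite big1 // => i _; rewrite (_ : _ == _ = false) ?mulr0 ?mul0rn //.
by apply: ltn_eqF; apply: leq_trans (ltn_ord i) _.
Qed.

Lemma comp_XsubC_exp_shift a i :
  (('X - a%:P) ^+ i) \Po ('X + a%:P) = 'X^i.
Proof. by rewrite rmorphXn /= comp_polyB comp_polyX comp_polyC addrK. Qed.

Lemma coef_shift_dvdp n p a j :
  ('X - a%:P) ^+ n %| p -> (j < n)%N -> (p \Po ('X + a%:P))`_j = 0.
Proof.
case/dvdpP => q -> jn.
by rewrite comp_polyM comp_XsubC_exp_shift coefMXn jn.
Qed.

Lemma dvdp_deriv_XsubC_exp n p a :
  ('X - a%:P) ^+ n.+1 %| p -> ('X - a%:P) ^+ n %| p^`().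
Proof.
case/dvdpP => q ->; rewrite derivM deriv_exp derivXsubC mul1r /=.
apply: dvdp_add; first by rewrite exprS mulrA dvdp_mull.
by rewrite mulrnAr -mulrnAl dvdp_mull.
Qed.

End Taylor.

(** * Taylor sections of fractions *)

Section FractionTaylor.
Variable F : fieldType.
Implicit Types (p q W : {poly F}) (a : F).

(** Differentiating [W * q = p + (X - a)^K * u] costs one power of [X - a]
    and shows that [W^`()] approximates the fraction given by the quotient rule,
    whose denominator [q ^+ 2] is still regular at [a]. *)
Lemma fraceval_fracderivn K W p q a i :
    q.[a] != 0 -> ('X - a%:P) ^+ K %| W * q - p -> (i < K)%N ->
  fraceval (fracderivn i (p%:F / q%:F)) a = W^`(i).[a].
Proof.
elim: i => [|i IHi] in K W p q *.
  case: K => // K qa dvdW _; rewrite /fracderivn /= fraceval_div //.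
  have: root (W * q - p) a.
    by rewrite -dvdp_XsubCl (dvdp_trans _ dvdW) // exprS dvdp_mulIl.
  rewrite rootE !hornerE subr_eq0 => /eqP <-.
  by rewrite mulfK.
case: K => // K qa dvdW iK.
have q0 : q != 0 by apply: contraNneq qa => ->; rewrite horner0.
rewrite /fracderivn iterSr fracderiv_div // derivSn.
apply: IHi iK; first by rewrite !hornerE expf_neq0.
have -> : W^`() * q ^+ 2 - (p^`() * q - p * q^`())
  = (W * q - p)^`() * q - q^`() * (W * q - p).
  by rewrite derivB derivM; ring.
apply: dvdp_sub; first by rewrite dvdp_mulr ?dvdp_deriv_XsubC_exp.
by rewrite dvdp_mull // (dvdp_trans _ dvdW) // dvdp_exp2l.
Qed.

Lemma exists_inverse_mod_XsubC_exp K q a : q.[a] != 0 ->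
  exists W, ('X - a%:P) ^+ K %| W * q - 1.
Proof.
move=> qa; have: coprimep q (('X - a%:P) ^+ K).
  by rewrite coprimep_expr // coprimep_XsubC.
case/Bezout_eq1_coprimepP => -[u v] /= <-; exists u.
by rewrite opprD addrA subrr add0r dvdpNr dvdp_mull.
Qed.

(** Characteristic zero lets [i!] be inverted, which turns the [i]th derivative
    into the Taylor coefficient of order [i]. *)
Lemma dvdp_mul_taylor_section K q a : [pchar F] =i pred0 -> q.[a] != 0 ->
  ('X - a%:P) ^+ K %| q * (\sum_(0 <= i < K)
    ((i`!%:R)^-1 * fraceval (fracderivn i (q%:F)^-1) a) *: ('X - a%:P) ^+ i) - 1.
Proof.
move=> hF qa; have [W dvdW] := exists_inverse_mod_XsubC_exp K q a qa.
rewrite big_mkord.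
have -> : \sum_(i < K) ((i`!%:R)^-1 * fraceval (fracderivn i (q%:F)^-1) a)
    *: ('X - a%:P) ^+ i = \sum_(i < K) W^`N(i).[a] *: ('X - a%:P) ^+ i.
  apply: eq_bigr => i _; congr (_ *: _).
  rewrite -[(q%:F)^-1]mul1r -(tofrac1 {poly F}).
  rewrite (@fraceval_fracderivn K W) // nderivn_def hornerMn.
  rewrite -[_.[_] *+ _]mulr_natl mulKf //.
  by rewrite (pcharf0P F).1 // -lt0n fact_gt0.
have := dvdp_sub_taylor F K W a; set T := \sum_(i < K) _ => dvdT.
have -> : q * T - 1 = (W * q - 1) - q * (W - T) by ring.
by rewrite dvdp_sub // dvdp_mull.
Qed.

End FractionTaylor.

(** * Hermite polynomials as a dual basis *)

Section Hermite.
Variables (F : fieldType) (s : nat) (alpha : 'I_s -> F) (m : 'I_s -> nat).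

Lemma cofpoly_neq0 r : injective alpha -> (cofpoly alpha m r).[alpha r] != 0.
Proof.
move=> inj; rewrite horner_prod; apply/prodf_neq0 => i ir.
by rewrite horner_exp expf_neq0 // !hornerE subr_eq0 (inj_eq inj) eq_sym.
Qed.

Lemma size_cofpoly r :
  (size (cofpoly alpha m r) <= (\sum_(k < s | k != r) m k).+1)%N.
Proof.
apply: leq_trans (size_poly_prod_leq _ _) _.
under eq_bigr => i _ do rewrite size_exp_XsubC -addn1.
by rewrite big_split /= sum1_card -addSn addnK.
Qed.

Lemma size_hermpoly r k : (k < m r)%N ->
  (size (hermpoly alpha m r k) <= \sum_(i < s) m i)%N.
Proof.
move=> km; rewrite /hermpoly; set T : {poly F} := \sum_(0 <= i < _) _.
have sT : (size T <= m r - k)%N.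
  apply: leq_trans (size_sum _ _ _) _.
  apply/bigmax_leqP_seq => i; rewrite mem_index_iota => /andP[_ ilt] _.
  apply: leq_trans (size_scale_leq _ _) _; rewrite size_exp_XsubC; lia.
set Q := cofpoly alpha m r; set B : {poly F} := ('X - _) ^+ k.
have sQ : (size Q <= (\sum_(i < s | i != r) m i).+1)%N := size_cofpoly r.
have sB : size B = k.+1 := size_exp_XsubC k (alpha r).
have sQB : (size (Q * B)%R <= (size Q + size B).-1)%N := size_polyMleq Q B.
have sQBT : (size (Q * B * T)%R <= (size (Q * B)%R + size T).-1)%N :=
  size_polyMleq _ _.
rewrite [leqRHS](bigD1 r) //=; apply: leq_trans sQBT _.
move: sQ sB sQB sT km; move: (size Q) (size B) (size (Q * B)%R) (size T).
by move: (\sum_(i < s | i != r) m i)%N; lia.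
Qed.

Lemma hermpoly_other_node r k i : k != r ->
  ('X - (alpha k)%:P) ^+ m k %| hermpoly alpha m r i.
Proof.
move=> kr; rewrite /hermpoly -mulrA dvdp_mulr //.
by rewrite /cofpoly (bigD1 k) //= dvdp_mulIl.
Qed.

(** With [K = m r - i], the cofactor times its Taylor section of length [K] is 1
    modulo [(X - alpha r)^K]; the factor [(X - alpha r)^i] raises the precision
    to [m r]. *)
Lemma hermpoly_same_node r i : [pchar F] =i pred0 -> injective alpha ->
    (i < m r)%N ->
  ('X - (alpha r)%:P) ^+ m r
    %| hermpoly alpha m r i - ('X - (alpha r)%:P) ^+ i.
Proof.
move=> hF inj im.
have := dvdp_mul_taylor_section F (m r - i) _ _ hF (cofpoly_neq0 r inj).
rewrite /hermpoly -/(cofinv alpha m r).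
have -> : (m r - 1 - i).+1 = (m r - i)%N by lia.
set T := \sum_(0 <= _ < _) _; set Q := cofpoly _ _ _ => dvdT.
rewrite -{1}(subnK (ltnW im)) exprD.
have -> : Q * ('X - (alpha r)%:P) ^+ i * T - ('X - (alpha r)%:P) ^+ i
  = (Q * T - 1) * ('X - (alpha r)%:P) ^+ i by ring.
by rewrite dvdp_mul.
Qed.

(** Duality: the Hermite polynomials against the functionals taking the Taylor
    coefficients of order less than the multiplicity at each node. *)
Lemma coef_shift_hermpoly r k i j : [pchar F] =i pred0 -> injective alpha ->
    (i < m r)%N -> (j < m k)%N ->
  (hermpoly alpha m r i \Po ('X + (alpha k)%:P))`_j
    = ((r == k) && (i == j))%:R.
Proof.
move=> hF inj im; case: (eqVneq r k) => [<-|rk] jm; last first.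
  apply: coef_shift_dvdp jm; apply: hermpoly_other_node.
  by rewrite eq_sym.
have := coef_shift_dvdp _ _ _ _ _ (hermpoly_same_node r i hF inj im) jm.
rewrite comp_polyB comp_XsubC_exp_shift coefB coefXn => /eqP.
by rewrite subr_eq0 eq_sym => /eqP <-; rewrite eq_sym.
Qed.

Lemma hermite_blockE n r (i : 'I_(m r)) (j : 'I_n) : [pchar F] =i pred0 ->
  hermite_block alpha m n r i j = (hermpoly alpha m r i)`_j.
Proof.
move=> hF; rewrite mxE horner_coef0 coef_derivn addn0 ffactnn.
by rewrite -[_`_j *+ _]mulr_natl mulKf // (pcharf0P F).1 // -lt0n fact_gt0.
Qed.

Lemma hermite_mul_vandermonde : [pchar F] =i pred0 -> injective alpha ->
  let n := (\sum_(k < s) m k)%N in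
  hermite_matrix alpha m n *m confluent_vandermonde alpha m n = 1%:M.
Proof.
move=> hF inj n; rewrite /hermite_matrix /confluent_vandermonde.
rewrite mul_mxcol_mxrow -mxdiagZ; apply: eq_mxblock => r k.
apply/matrixP => i j; rewrite mxE.
under eq_bigr => l _ do rewrite hermite_blockE // mxE.
rewrite -coef_shift ?size_hermpoly // coef_shift_hermpoly //.
(* The identity written by blocks has in position (r, k) the identity of size
   [m r] transported along [r = k], hence the elimination of that equality. *)
case: eqVneq => [rk|_] /=; last by rewrite mxE.
by case: _ / rk in j *; rewrite conform_mx_id mxE.
Qed.

End Hermite.

Theorem theorem2p4 (F : fieldType) (hF : [pchar F] =i pred0)
    (s : nat) (alpha : 'I_s -> F) (halpha : injective alpha)
    (m : 'I_s -> nat) (hm : forall j : 'I_s, (0 < m j)%N) :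
  let n := (\sum_(k < s) m k)%N in
  confluent_vandermonde alpha m n \in unitmx /\
  invmx (confluent_vandermonde alpha m n) = hermite_matrix alpha m n.
Proof.
move=> n; have HV := hermite_mul_vandermonde F s alpha m hF halpha.
have [_ uV] := mulmx1_unit HV; split=> //.
by rewrite -[LHS]mul1mx -HV mulmxK.
Qed.
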